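(* Let $A \in L(H)$ and $\rho > 0$ with $\sigma(A) \cap S_\rho = \emptyset$, and set $M_\rho \coloneqq \sup_{z \in S_\rho} |(z-A)^{-1}|_{L(H)} < \infty$. Let $F \colon \ell_{2,\rho}(\mathbb{Z}; H) \to \ell_{2,\rho}(\mathbb{Z}; H)$ be Lipschitz continuous with Lipschitz constant $|F|_{\operatorname{Lip}(\ell_{2,\rho}(\mathbb{Z}; H))} < 1/M_\rho$. Then for each $x \in H$ there exists a unique $u \in \ell_{2,\rho}(\mathbb{Z}; H)$ with $$\tau u = Au + F(u) + \delta_{-1} x.$$
   Context: $H$ is a separable complex Hilbert space, $\sigma(A)$ is the spectrum of $A$, $S_\rho = \{z\in\mathbb{C}: |z|=\rho\}$. $\ell_{2,\rho}(\mathbb{Z}; H) = \{u \in H^{\mathbb{Z}} : \sum_{k} |u_k|_H^2 \rho^{-2k} < \infty\}$ with norm $(\sum_k|u_k|_H^2\rho^{-2k})^{1/2}$. $\tau$ is the shift $(\tau u)_n = u_{n+1}$, $Au = (Au_n)_n$, and $\delta_{-1}x$ is the sequence with entry $x$ at index $-1$ and $0$ elsewhere. *)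

(* Defs.v *)
From HB Require Import structures.
From mathcomp Require Import all_boot all_order all_algebra.
From mathcomp Require Import all_classical all_reals all_analysis.
From mathcomp Require Import complex.
Set Implicit Arguments. Unset Strict Implicit. Unset Printing Implicit Defensive.
Import Order.TTheory GRing.Theory Num.Theory.
Import numFieldNormedType.Exports.
Local Open Scope classical_set_scope.
Local Open Scope ring_scope.
Local Open Scope complex_scope.

Section Defs.
Variable R : realType.
Local Notation C := R[i].
Variable H : normedModType C.

Definition hnorm (x : H) : R := complex.Re `|x|.

Definition is_inner_product (ip : H -> H -> C) : Prop :=
  [/\ forall (a : C) (x y z : H), ip (a *: x + y) z = a * ip x z + ip y z,
      forall x y : H, ip y x = conjc (ip x y)
    & forall x : H, ip x x = `|x| ^+ 2].

(* H is a separable complex Hilbert space (completeness is part of the type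
   completeNormedModType, used in the theorem). *)
Definition separable_hilbert : Prop :=
  (exists ip, is_inner_product ip) /\
  (exists f : nat -> H, dense (range f)).

Definition bounded_op (B : H -> H) : Prop := linear B /\ continuous B.

Definition is_resolvent (A : H -> H) (z : C) (B : H -> H) : Prop :=
  bounded_op B /\
  (forall x, B (z *: x - A x) = x) /\ (forall x, z *: B x - A (B x) = x).

Definition spectrum (A : H -> H) : set C :=
  [set z | ~ exists B, is_resolvent A z B].

Definition circle (rho : R) : set C := [set z | `|z| = rho%:C].

Definition opnorm (B : H -> H) : R :=
  inf [set M : R | 0 <= M /\ forall x, hnorm (B x) <= M * hnorm x].

Definition resolvent_norms (A : H -> H) (rho : R) : set R :=
  [set m | exists z B, circle rho z /\ is_resolvent A z B /\ m = opnorm B].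
Definition M_rho (A : H -> H) (rho : R) : R := sup (resolvent_norms A rho).

Definition l2rho_sum (rho : R) (u : int -> H) : \bar R :=
  (\esum_(k in [set: int]) ((hnorm (u k)) ^+ 2 * rho ^ (- (2 * k)))%:E)%E.
Definition in_l2rho (rho : R) (u : int -> H) : Prop :=
  (l2rho_sum rho u < +oo)%E.
Definition l2rho_norm (rho : R) (u : int -> H) : R :=
  Num.sqrt (fine (l2rho_sum rho u)).

Definition l2rho_selfmap (rho : R) (F : (int -> H) -> (int -> H)) : Prop :=
  forall u, in_l2rho rho u -> in_l2rho rho (F u).
Definition l2rho_lipschitz (rho : R) (F : (int -> H) -> (int -> H)) (L : R)
  : Prop :=
  0 <= L /\ forall u v, in_l2rho rho u -> in_l2rho rho v ->
    l2rho_norm rho (F u - F v) <= L * l2rho_norm rho (u - v).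
Definition lipconst (rho : R) (F : (int -> H) -> (int -> H)) : R :=
  inf [set L | l2rho_lipschitz rho F L].

Definition tau_shift (u : int -> H) : int -> H := fun n => u (n + 1)%R.
Definition delta_m1 (x : H) : int -> H := fun n => if n == (-1)%R then x else 0.

End Defs.

(* Main.v *)
(* Put T = tau - A. Sampling the symbol z - A at the points of S_rho with
   z = rho * (n-th root of unity) and using Parseval for the discrete Fourier
   transform of H-valued n-periodic sequences, the resolvent bound gives
   |u| <= M_rho |T u| first in the periodic setting, then on l_{2,rho}: cut a
   sequence to long windows whose end points carry arbitrarily small terms.
   Inverting the transform solves T y = delta_m x periodically; cutting y at an
   index where it is small, which exists by pigeonhole, shows that T has dense
   range. Hence T is bijective on l_{2,rho} with |T^-1| <= M_rho, and
   u |-> T^-1 (F u + delta_{-1} x) is a contraction. *)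
Require Import Defs.
From HB Require Import structures.
From mathcomp Require Import all_boot all_order all_algebra.
From mathcomp Require Import cyclic separable cyclotomic.
From mathcomp Require Import all_classical all_reals all_analysis.
From mathcomp Require Import complex.
From mathcomp Require Import ring lra zify.
Set Implicit Arguments. Unset Strict Implicit. Unset Printing Implicit Defensive.
Import Order.TTheory GRing.Theory Num.Theory.
Import numFieldNormedType.Exports.
Local Open Scope classical_set_scope.
Local Open Scope ring_scope.
Local Open Scope complex_scope.

(** * Roots of unity and geometric estimates *)

Lemma prim_root_exists (F : closedFieldType) (n : nat) :
  n%:R != 0 :> F -> exists z : F, n.-primitive_root z.
Proof.
move=> n0; have n_gt0 : (0 < n)%N by case: n n0 => //; rewrite eqxx.
(* The roots of ['X^n - 1] are distinct because [n] is nonzero in [F], and [n] distinct [n]-th roots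
   of unity include a primitive one. *)
have [r Dp] := closed_field_poly_normal ('X^n - 1 : {poly F}).
rewrite (monicP _) ?monicXnsubC // scale1r in Dp.
have rn1: all n.-unity_root r by apply/allP=> z; rewrite -root_prod_XsubC -Dp.
have sz_r: (n < (size r).+1)%N.
  by rewrite -(size_prod_XsubC r id) -Dp size_XnsubC.
have [|z] := hasP (has_prim_root n_gt0 rn1 _ sz_r); last by exists z.
by rewrite -separable_prod_XsubC -Dp separable_Xn_sub_1.
Qed.

(** Orthogonality of the characters of Z/n: off the diagonal the ratio w is not 1 but w^n = 1, so
    multiplying the geometric sum by w - 1 gives 0. *)
Lemma sum_prim_root_expr (F : fieldType) (n : nat) (z : F) (k l : 'I_n) :
  n.-primitive_root z ->
  \sum_(j < n) (z ^+ k / z ^+ l) ^+ j = if k == l then n%:R else 0.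
Proof.
move=> zn; have z0 : z != 0.
  by rewrite (prim_root_eq0 zn) -lt0n (prim_order_gt0 zn).
case: eqVneq => [->|kl].
  rewrite divff ?expf_neq0 //.
  under eq_bigr do rewrite expr1n.
  by rewrite sumr_const card_ord.
have w1 : z ^+ k / z ^+ l != 1.
  apply: contra kl => /eqP /divr1_eq /eqP.
  by rewrite (eq_prim_root_expr zn) !modn_small.
have : (z ^+ k / z ^+ l - 1) * \sum_(j < n) (z ^+ k / z ^+ l) ^+ j = 0.
  rewrite -subrX1 expr_div_n -!exprM ![(_ * n)%N]mulnC !exprM.
  by rewrite (prim_expr_order zn) !expr1n divr1 subrr.
by move/eqP; rewrite mulf_eq0 subr_eq0 (negbTE w1) /= => /eqP.
Qed.

(** The relation [N x a] stands for a bound of size [a] on [x]; keeping it abstract serves both the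
    norm of [H] and the weighted sequence norm. *)
Lemma geometric_tail (R : realType) (V : zmodType) (N : V -> R -> Prop)
    (u : nat -> V) (c q : R) :
  N 0 0 -> (forall x y a b, N x a -> N y b -> N (x + y) (a + b)) ->
  (forall x a b, a <= b -> N x a -> N x b) ->
  0 <= q < 1 -> 0 <= c -> (forall n, N (u n.+1 - u n) (c * q ^+ n)) ->
  forall n m, N (u (n + m)%N - u n) (c * q ^+ n / (1 - q)).
Proof.
move=> N0 ND Nle /andP[q0 q1] c0 hu n m.
have Q : 0 < 1 - q by rewrite subr_gt0.
(* The induction runs on the exact partial sum of the geometric series, hence the factor
   [1 - q ^+ m]. *)
apply: (Nle _ (c * q ^+ n * (1 - q ^+ m) / (1 - q))).
  rewrite ler_wpM2r ?invr_ge0 ?(ltW Q) //.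
  by rewrite ler_piMr ?mulr_ge0 ?exprn_ge0 // gerBl exprn_ge0.
elim: m => [|m IH]; first by rewrite addn0 !subrr mulr0 mul0r.
rewrite addnS (_ : u _ - u n = (u (n + m).+1 - u (n + m)%N) + (u (n + m)%N - u n));
  last by rewrite addrA subrK.
apply: Nle (ND _ _ _ _ (hu _) IH).
rewrite exprD exprS le_eqVlt; apply/orP; left; apply/eqP.
by field; rewrite gt_eqF.
Qed.

Lemma geometric_small (R : realType) (c q e : R) :
  0 <= q < 1 -> 0 < e -> exists n, c * q ^+ n / (1 - q) < e.
Proof.
move=> /andP[q0 q1] e0.
have /cvgrPdist_lt/(_ _ e0)[n _ /(_ n (leqnn n))] :
    (fun n => c / (1 - q) * q ^+ n) @ \oo --> (c / (1 - q) * 0 : R).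
  by apply: cvgMr; apply: cvg_expr; rewrite ger0_norm.
rewrite /= mulr0 sub0r normrN => h; exists n.
by apply: le_lt_trans h; rewrite mulrAC; apply: ler_norm.
Qed.

(** * The real-valued norm of [H] and convergence at a geometric rate *)

Section ComplexNorm.
Variables (R : realType) (H : completeNormedModType R[i]).
Implicit Types x y : H.

Lemma normE x : `|x| = (hnorm x)%:C.
Proof. by rewrite /hnorm RRe_real ?normr_real. Qed.

Lemma hnorm_ge0 x : 0 <= hnorm x.
Proof. by rewrite -ler0c -normE. Qed.

Lemma hnorm0 : hnorm (0 : H) = 0.
Proof. by rewrite /hnorm normr0. Qed.

Lemma hnorm_eq0 x : hnorm x = 0 -> x = 0.
Proof. by move=> h; apply/eqP; rewrite -normr_eq0 normE h. Qed.

Lemma hnormN x : hnorm (- x) = hnorm x.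
Proof. by rewrite /hnorm normrN. Qed.

Lemma ler_hnormD x y : hnorm (x + y) <= hnorm x + hnorm y.
Proof. by rewrite -lecR rmorphD /= -!normE ler_normD. Qed.

Lemma hnormZ (a : R[i]) x : hnorm (a *: x) = complex.Re `|a| * hnorm x.
Proof.
by apply: complexI; rewrite rmorphM /= (RRe_real (normr_real a)) -!normE normrZ.
Qed.

Lemma hnormZr (a : R) x : 0 <= a -> hnorm (a%:C *: x) = a * hnorm x.
Proof. by move=> a0; rewrite hnormZ ger0_norm // ler0c. Qed.

Lemma hnorm_le_eps x : (forall e, 0 < e -> hnorm x <= e) -> x = 0.
Proof.
move=> h; apply: hnorm_eq0; apply/eqP; rewrite eq_le hnorm_ge0 andbT.
by apply/ler_addgt0Pr => e /h; rewrite add0r.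
Qed.

Lemma geometric_cvg (u : nat -> H) (c q : R) : 0 <= q < 1 -> 0 <= c ->
  (forall n, hnorm (u n.+1 - u n) <= c * q ^+ n) ->
  exists l, forall n, hnorm (l - u n) <= c * q ^+ n / (1 - q).
Proof.
move=> /andP[q0 q1] c0 hu.
have q01 : 0 <= q < 1 by rewrite q0 q1.
have tail : forall n m, hnorm (u (n + m)%N - u n) <= c * q ^+ n / (1 - q).
  apply: (@geometric_tail _ _ (fun x a => hnorm x <= a)) => //.
  - by rewrite hnorm0.
  - by move=> x y a b xa yb; apply: le_trans (ler_hnormD _ _) (lerD xa yb).
  - by move=> x a b ab /le_trans; apply.
have uc : cvgn u.
  apply: cauchy_cvg; apply: cauchy_exP => e e0.
  have er : e = (complex.Re e)%:C by rewrite RRe_real // gtr0_real.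
  have [n hn] : exists n, c * q ^+ n / (1 - q) < complex.Re e.
    by apply: geometric_small; rewrite ?q01 // -ltcR -er.
  exists (u n); exists n => // m /= nm.
  rewrite -ball_normE /= distrC normE er ltcR.
  by rewrite -(subnKC nm); apply: le_lt_trans hn.
exists (lim (u @ \oo)) => n; apply/ler_addgt0Pr => e e0.
have eC : 0 < e%:C by rewrite ltcR.
have /cvgrPdist_lt/(_ _ eC)[N _ /(_ (n + N)%N (leq_addl _ _))] := uc.
rewrite /= normE ltcR => h.
rewrite (_ : _ - u n = (lim (u @ \oo) - u (n + N)%N) + (u (n + N)%N - u n));
  last by rewrite addrA subrK.
by apply: le_trans (ler_hnormD _ _) _; rewrite addrC lerD // ltW.
Qed.

Lemma geometric_hnorm_cvg (u : nat -> H) (l : H) (c q : R) : 0 <= q < 1 ->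
  (forall n, hnorm (l - u n) <= c * q ^+ n) -> u @ \oo --> l.
Proof.
move=> /andP[q0 q1] h; apply/cvgrPdist_lt => e e0.
have er : e = (complex.Re e)%:C by rewrite RRe_real // gtr0_real.
have er0 : 0 < complex.Re e by rewrite -ltcR -er.
have /cvgrPdist_lt/(_ _ er0) : (fun n => c * q ^+ n) @ \oo --> (c * 0 : R).
  by apply: cvgMr; apply: cvg_expr; rewrite ger0_norm.
apply: filterS => n; rewrite mulr0 sub0r normrN => hn.
by rewrite normE er ltcR; apply: le_lt_trans (h n) (le_lt_trans (ler_norm _) hn).
Qed.

End ComplexNorm.

(** * Parseval's identity for the discrete Fourier transform *)

Section Parseval.
Variables (R : realType) (H : completeNormedModType R[i]).
Variable ip : H -> H -> R[i].
Hypothesis ipP : is_inner_product ip.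

Lemma ip_suml (I : finType) (a : I -> R[i]) (x : I -> H) z :
  ip (\sum_i a i *: x i) z = \sum_i a i * ip (x i) z.
Proof.
have [lin _ _] := ipP.
have ip0 : ip 0 z = 0.
  have := lin 1 0 0 z; rewrite scaler0 addr0 mul1r => /eqP.
  by rewrite -subr_eq0 opprD addrA subrr sub0r oppr_eq0 => /eqP.
elim/big_rec2: _ => // i y1 y2 _ <-; exact: lin.
Qed.

Lemma ip_sumr (I : finType) (a : I -> R[i]) (x : I -> H) z :
  ip z (\sum_i a i *: x i) = \sum_i conjc (a i) * ip z (x i).
Proof.
have [_ sym _] := ipP; rewrite sym ip_suml rmorph_sum /=.
by apply: eq_bigr => i _; rewrite rmorphM /= -sym.
Qed.

Lemma hnorm_sqr_ip x : (hnorm x ^+ 2)%:C = ip x x.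
Proof. by have [_ _ ->] := ipP; rewrite normE rmorphXn. Qed.

Lemma norm_prim_root n (z : R[i]) : n.-primitive_root z -> `|z| = 1.
Proof.
move=> zn; apply/eqP; rewrite -(@pexpr_eq1 _ _ n) // ?(prim_order_gt0 zn) //.
by rewrite -normrX (prim_expr_order zn) normr1.
Qed.

(** Expanding each square as an inner product gives a triple sum; since the conjugate of [z] is its
    inverse, summing over [j] first leaves only the diagonal by character orthogonality. *)
Lemma parseval n (z : R[i]) (a : nat -> H) : n.-primitive_root z ->
  \sum_(j < n) hnorm (\sum_(k < n) z ^+ (j * k) *: a k) ^+ 2 =
  n%:R * \sum_(k < n) hnorm (a k) ^+ 2.
Proof.
move=> zn; apply: complexI; rewrite rmorphM /= !rmorph_sum /= rmorph_nat.
have zJ : conjc z = z^-1.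
  have := invc_norm z; rewrite (norm_prim_root zn) => ->.
  by rewrite expr1n invr1 mul1r.
under eq_bigr do rewrite hnorm_sqr_ip ip_suml.
transitivity (\sum_(j < n) \sum_(k < n) \sum_(l < n)
   (z ^+ k / z ^+ l) ^+ j * ip (a k) (a l)).
  apply: eq_bigr => j _; apply: eq_bigr => k _; rewrite ip_sumr mulr_sumr.
  apply: eq_bigr => l _; rewrite mulrA; congr (_ * _).
  rewrite rmorphXn /= zJ expr_div_n -!exprM ![(_ * j)%N]mulnC.
  by rewrite exprVn.
rewrite exchange_big /= mulr_sumr; apply: eq_bigr => k _.
rewrite exchange_big /= (bigD1 k) //= [X in _ + X]big1 => [|l lk].
  by rewrite -mulr_suml sum_prim_root_expr // eqxx addr0 hnorm_sqr_ip.
by rewrite -mulr_suml sum_prim_root_expr // eq_sym (negbTE lk) mul0r.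
Qed.

End Parseval.

(** * Inequalities for finite sums of squares *)

Lemma minkowski2_seq (R : realType) (I : eqType) (s : seq I) (a b : I -> R)
    (p q : R) : 0 <= p -> 0 <= q ->
  \sum_(i <- s) a i ^+ 2 <= p ^+ 2 -> \sum_(i <- s) b i ^+ 2 <= q ^+ 2 ->
  \sum_(i <- s) (a i + b i) ^+ 2 <= (p + q) ^+ 2.
Proof.
(* The weight used below needs [p] and [q] nonzero, so a zero bound is treated apart: it forces
   every term on its side to vanish. *)
have zero (f : I -> R) : \sum_(i <- s) f i ^+ 2 <= 0 ^+ 2 -> {in s, f =1 fun=> 0}.
  rewrite expr0n /= => le0 i si.
  have : \sum_(i <- s) f i ^+ 2 == 0.
    by rewrite eq_le le0 sumr_ge0 // => j _; apply: sqr_ge0.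
  rewrite psumr_eq0 => [/allP/(_ i si)|j _]; last exact: sqr_ge0.
  by rewrite /= sqrf_eq0 => /eqP.
rewrite le_eqVlt => /predU1P[<- _ /zero a0|p0].
  by rewrite add0r => hb; rewrite (eq_big_seq (fun i => b i ^+ 2)) // => i si;
    rewrite a0 // add0r.
rewrite le_eqVlt => /predU1P[<- ha /zero b0|q0 ha hb].
  by rewrite addr0 (eq_big_seq (fun i => a i ^+ 2)) // => i si;
    rewrite b0 // addr0.
(* weighted AM-GM, [2 a b <= (q / p) a^2 + (p / q) b^2] *)
pose t := q / p; have t0 : 0 < t by rewrite divr_gt0.
apply: (@le_trans _ _ (\sum_(i <- s) ((1 + t) * a i ^+ 2 + (1 + t^-1) * b i ^+ 2))).
  apply: ler_sum => i _; rewrite -subr_ge0.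
  have -> : (1 + t) * a i ^+ 2 + (1 + t^-1) * b i ^+ 2 - (a i + b i) ^+ 2
    = t * (a i - t^-1 * b i) ^+ 2 by field; rewrite gt_eqF.
  by rewrite mulr_ge0 ?sqr_ge0 // ltW.
rewrite big_split /= -!mulr_sumr.
have -> : (p + q) ^+ 2 = (1 + t) * p ^+ 2 + (1 + t^-1) * q ^+ 2.
  by rewrite /t; field; rewrite !gt_eqF.
by apply: lerD; apply: ler_wpM2l => //; rewrite addr_ge0 // ?invr_ge0 ltW.
Qed.

Lemma ler_sum_seq_sub (R : realType) (I : eqType) (s w : seq I) (f : I -> R) :
  uniq s -> uniq w -> (forall i, 0 <= f i) ->
  (forall i, i \in s -> i \notin w -> f i = 0) ->
  \sum_(i <- s) f i <= \sum_(i <- w) f i.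
Proof.
move=> us uw f0 fs.
rewrite (bigID (mem w)) /= [X in _ + X]big_seq_cond [X in _ + X]big1 ?addr0; last first.
  by move=> i /andP[si wi]; rewrite fs.
rewrite -big_filter (perm_big [seq i <- w | i \in s]) /=; last first.
  apply: uniq_perm; rewrite ?filter_uniq // => i.
  by rewrite !mem_filter /= andbC.
rewrite big_filter [leRHS](bigID (mem s)) /= lerDl.
by apply: sumr_ge0.
Qed.

Lemma ler_sqr_addgt0 (R : realType) (x a : R) :
  0 <= a -> (forall e, 0 < e -> x <= (a + e) ^+ 2) -> x <= a ^+ 2.
Proof.
move=> a0 h; have [x0|x0] := leP x 0; first by rewrite (le_trans x0) ?sqr_ge0.
rewrite -(sqr_sqrtr (ltW x0)) ler_pXn2r ?nnegrE ?sqrtr_ge0 //.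
apply/ler_addgt0Pr => e e0.
have ae : 0 <= a + e by rewrite addr_ge0 // ltW.
by rewrite -(ger0_norm ae) -sqrtr_sqr ler_wsqrtr ?h.
Qed.

(** * The weighted sequence space and its completeness *)

Section WeightedL2.
Variables (R : realType) (H : completeNormedModType R[i]) (rho : R).
Hypothesis rho0 : 0 < rho.
Implicit Types (u v : int -> H) (c d : R).

(** The square root of a summand of [l2rho_sum], so that the triangle inequality holds term by
    term. *)
Definition wnorm u (k : int) : R := hnorm (u k) * rho ^ (- k).

(* [u] lies in the weighted space, with norm at most [c]. *)
Definition l2le u c : Prop :=
  0 <= c /\ forall s, uniq s -> \sum_(k <- s) wnorm u k ^+ 2 <= c ^+ 2.

Lemma wnorm_sqr u k : wnorm u k ^+ 2 = hnorm (u k) ^+ 2 * rho ^ (- (2 * k)).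
Proof.
by rewrite exprMn; congr (_ * _); rewrite exprnP exprz_exp mulNr mulrC.
Qed.

Lemma exprz_rho_gt0 (k : int) : 0 < rho ^ k.
Proof. exact: exprz_gt0. Qed.

Lemma wnorm_ge0 u k : 0 <= wnorm u k.
Proof. by rewrite mulr_ge0 ?hnorm_ge0 // ltW ?exprz_rho_gt0. Qed.

Lemma wnormD u v k : wnorm (u + v) k <= wnorm u k + wnorm v k.
Proof.
by rewrite -mulrDl ler_wpM2r ?ler_hnormD // ltW ?exprz_rho_gt0.
Qed.

Lemma l2le_wnorm u c k : l2le u c -> wnorm u k <= c.
Proof.
move=> [c0 /(_ [:: k] isT)]; rewrite big_seq1.
by rewrite ler_pXn2r // nnegrE wnorm_ge0.
Qed.

Lemma l2le_le u c d : c <= d -> l2le u c -> l2le u d.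
Proof.
move=> cd [c0 h]; have d0 := le_trans c0 cd; split=> // s us.
by apply: le_trans (h _ us) _; rewrite ler_pXn2r.
Qed.

Lemma l2le0 : l2le 0 0.
Proof.
by split=> // s _; rewrite big1 ?expr0n // => k _; rewrite /wnorm hnorm0 mul0r expr0n.
Qed.

Lemma l2leD u v c d : l2le u c -> l2le v d -> l2le (u + v) (c + d).
Proof.
move=> [c0 hu] [d0 hv]; split; first exact: addr_ge0.
move=> s us; apply: le_trans (minkowski2_seq c0 d0 (hu _ us) (hv _ us)).
apply: ler_sum => k _; rewrite ler_pXn2r ?nnegrE ?wnormD ?wnorm_ge0 //.
by rewrite addr_ge0 ?wnorm_ge0.
Qed.

Lemma l2leN u c : l2le u c -> l2le (- u) c.
Proof.
move=> [c0 hu]; split=> // s /hu; congr (_ <= _); apply: eq_bigr => k _.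
by rewrite /wnorm -(hnormN (u k)).
Qed.

Lemma l2leB u v c d : l2le u c -> l2le v d -> l2le (u - v) (c + d).
Proof. by move=> hu /l2leN; apply: l2leD. Qed.

Lemma l2le_small u v : (forall e, 0 < e -> l2le (u - v) e) -> u = v.
Proof.
move=> h; apply/funext => k; apply/eqP; rewrite -subr_eq0; apply/eqP.
apply: hnorm_le_eps => e e0.
have := l2le_wnorm k (h _ (mulr_gt0 e0 (exprz_rho_gt0 (- k)))).
by rewrite /wnorm ler_pM2r ?exprz_rho_gt0.
Qed.

(** Link to the extended-real sum: it is a supremum over finite sets, each of which is listed
    without repetition. *)
Lemma l2le_esum u c : l2le u c -> (l2rho_sum rho u <= (c ^+ 2)%:E)%E.
Proof.
move=> [c0 hu]; apply: ub_ereal_sup => _ [X [Xfin _] <-].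
have [s us ->] : exists2 s : seq int, uniq s & X = [set` s].
  have [t ->] := (finite_seqP X).1 Xfin.
  exists (undup t); rewrite ?undup_uniq //.
  by apply/seteqP; split=> i /=; rewrite mem_undup.
rewrite -fsbig_seq // sumEFin lee_fin.
apply: le_trans (hu _ us); rewrite le_eqVlt; apply/orP; left; apply/eqP.
by apply: eq_bigr => k _; rewrite wnorm_sqr.
Qed.


Lemma l2le_in_l2rho u c : l2le u c -> in_l2rho rho u.
Proof.
by move=> /l2le_esum; rewrite /in_l2rho => /le_lt_trans; apply; rewrite ltry.
Qed.

Lemma l2rho_sum_ge0 u : (0 <= l2rho_sum rho u)%E.
Proof.
apply: esum_ge0 => k _; rewrite lee_fin mulr_ge0 ?sqr_ge0 //.
by rewrite ltW ?exprz_rho_gt0.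
Qed.

Lemma l2le_norm_le u c : l2le u c -> l2rho_norm rho u <= c.
Proof.
move=> h; have [c0 _] := h.
rewrite /l2rho_norm -(ger0_norm c0) -sqrtr_sqr ler_sqrt ?sqr_ge0 //.
rewrite -lee_fin fineK; first exact: l2le_esum.
by rewrite ge0_fin_numE ?l2rho_sum_ge0 // (l2le_in_l2rho h).
Qed.

Lemma in_l2rho_l2le u : in_l2rho rho u -> l2le u (l2rho_norm rho u).
Proof.
move=> h; split=> [|s us]; first exact: sqrtr_ge0.
rewrite sqr_sqrtr ?fine_ge0 ?l2rho_sum_ge0 //.
rewrite -lee_fin fineK ?ge0_fin_numE ?l2rho_sum_ge0 //.
apply: esum_ge; exists [set` s]; first by split=> //; apply: finite_seq.
rewrite -fsbig_seq // sumEFin lee_fin; apply: ler_sum => k _.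
by rewrite wnorm_sqr.
Qed.

Lemma l2le_finsupp u (w : seq int) : uniq w -> (forall k, k \notin w -> u k = 0) ->
  l2le u (Num.sqrt (\sum_(k <- w) wnorm u k ^+ 2)).
Proof.
move=> uw u0; split=> [|s us]; first exact: sqrtr_ge0.
rewrite sqr_sqrtr; last by apply: sumr_ge0 => k _; apply: sqr_ge0.
apply: ler_sum_seq_sub => // [k|k _ /u0 uk0]; first exact: sqr_ge0.
by rewrite /wnorm uk0 hnorm0 mul0r expr0n.
Qed.

Definition dirac_seq (m : int) (x : H) : int -> H := fun k => if k == m then x else 0.

Lemma l2le_dirac m x : l2le (dirac_seq m x) (hnorm x * rho ^ (- m)).
Proof.
have supp k : k \notin [:: m] -> dirac_seq m x k = 0.
  by rewrite inE /dirac_seq => /negbTE ->.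
apply: l2le_le (l2le_finsupp _ supp) => //.
rewrite big_seq1 sqrtr_sqr ger0_norm ?wnorm_ge0 //.
by rewrite /wnorm /dirac_seq eqxx.
Qed.

(** Pigeonhole: [N] distinct indices with terms above [e] would contribute at least [N * e ^+ 2],
    which exceeds [c ^+ 2] for large [N]. This supplies the end points of windows. *)
Lemma l2le_wnorm_small u c e (f : nat -> int) :
  l2le u c -> injective f -> 0 < e -> exists n, wnorm u (f n) <= e.
Proof.
move=> [c0 hu] finj e0; apply: contrapT => /forallNP big.
pose N := Num.bound (c ^+ 2 / e ^+ 2).
have e20 : 0 < e ^+ 2 by rewrite exprn_gt0.
have hN : c ^+ 2 < N%:R * e ^+ 2.
  rewrite -ltr_pdivrMr //; apply: archi_boundP.
  by rewrite divr_ge0 ?sqr_ge0 // ltW.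
have us : uniq [seq f n | n <- iota 0 N] by rewrite map_inj_uniq ?iota_uniq.
suff : N%:R * e ^+ 2 <= c ^+ 2 by rewrite leNgt hN.
apply: le_trans (hu _ us); rewrite big_map.
have -> : N%:R * e ^+ 2 = \sum_(n <- iota 0 N) e ^+ 2.
  by rewrite big_const_seq count_predT size_iota iter_addr_0 mulr_natl.
apply: ler_sum => n _; rewrite ler_pXn2r ?nnegrE ?wnorm_ge0 // ?ltW //.
by rewrite ltNge; apply/negP/big.
Qed.

(** Choose a finite partial sum within [e ^+ 2] of the supremum; appending indices outside [s] gives
    another admissible sum, so they add at most [e ^+ 2]. *)
Lemma l2le_tail u c e : l2le u c -> 0 < e -> exists2 s : seq int, uniq s &
  l2le (fun k => if k \in s then 0 else u k) e.
Proof.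
move=> [c0 hu] e0.
pose S := [set x | exists2 s : seq int, uniq s & x = \sum_(k <- s) wnorm u k ^+ 2].
have supS : has_sup S.
  split; first by exists 0, [::]; rewrite ?big_nil.
  by exists (c ^+ 2) => _ [s us ->]; apply: hu.
have [|_ [s us ->] hs] := sup_adherent (eps := e ^+ 2) _ supS.
  by rewrite exprn_gt0.
exists s => //; split=> [|t ut]; first exact: ltW.
rewrite (bigID (mem s)) /= big1 ?add0r => [|k ks]; last first.
  by rewrite /wnorm ks hnorm0 mul0r expr0n.
have /(ub_le_sup supS.2) :
    S (\sum_(k <- s ++ [seq k <- t | k \notin s]) wnorm u k ^+ 2).
  eexists; last by [].
  rewrite cat_uniq us filter_uniq // andbT; apply/hasPn => k.
  by rewrite mem_filter => /andP[].
rewrite big_cat /= big_filter -lerBrDl => /le_trans le.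
rewrite (eq_bigr (fun k => wnorm u k ^+ 2)) => [|k /negbTE ks]; last first.
  by rewrite /wnorm ks.
by apply: le; rewrite lerBlDr -lerBlDl ltW // ltrBlDl addrC -ltrBlDr.
Qed.

(** The limit is taken entry by entry in [H]; the norm estimate is then recovered on each finite
    list by passing through a far later member of the sequence. *)
Lemma l2le_complete (u : nat -> int -> H) (c q : R) :
  0 <= q < 1 -> 0 <= c -> (forall n, l2le (u n.+1 - u n) (c * q ^+ n)) ->
  exists l, forall n, l2le (l - u n) (c * q ^+ n / (1 - q)).
Proof.
move=> q01 c_ge0 hu.
have tail : forall n m, l2le (u (n + m)%N - u n) (c * q ^+ n / (1 - q)).
  apply: geometric_tail => //; first exact: l2le0.
  - by move=> x y a b; apply: l2leD.
  - by move=> x a b; apply: l2le_le.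
have [l hl] : exists l : int -> H, forall k n,
    hnorm (l k - u n k) <= c * rho ^ k * q ^+ n / (1 - q).
  suff h k : exists lk, forall n, hnorm (lk - u n k) <= c * rho ^ k * q ^+ n / (1 - q).
    by exists (fun k => sval (cid (h k))) => k; apply: svalP (cid (h k)).
  apply: geometric_cvg => // [|n].
    by rewrite mulr_ge0 // ltW ?exprz_rho_gt0.
  have := l2le_wnorm k (hu n); rewrite /wnorm.
  by rewrite -invr_expz -ler_pdivlMr ?invr_gt0 ?exprz_rho_gt0 // invrK mulrAC.
exists l => n; have [a0 _] := tail n 0%N; split=> // s us.
(* [b m] is a crude bound for [l - u m] on [s], summing the entrywise bounds. It depends on [s] but
   tends to 0, so [b (n + m)] drops below any [e] and only [a] survives. *)
set a := c * _ / _; pose b m := (size s)%:R * (c * q ^+ m / (1 - q)).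
have b0 m : 0 <= b m by rewrite mulr_ge0 ?ler0n //; have [] := tail m 0%N.
have hb m : \sum_(k <- s) wnorm (l - u m) k ^+ 2 <= b m ^+ 2.
  apply: (@le_trans _ _ (\sum_(k <- s) (c * q ^+ m / (1 - q)) ^+ 2)).
    apply: ler_sum => k _; rewrite ler_pXn2r ?nnegrE ?wnorm_ge0 //; last first.
      by have [] := tail m 0%N.
    rewrite /wnorm -invr_expz ler_pdivrMr ?exprz_rho_gt0 //.
    by rewrite mulrAC [c * _ * _]mulrAC; apply: hl.
  rewrite big_const_seq count_predT iter_addr_0 -mulr_natl /b [leRHS]exprMn.
  rewrite ler_wpM2r ?sqr_ge0 // -natrX ler_nat.
  by case: (size s) => // N; rewrite -[leqLHS]mul1n leq_mul2r orbT.
apply: ler_sqr_addgt0 => // e e0.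
have [m hm] := geometric_small ((size s)%:R * c * q ^+ n) q01 e0.
have [_ h] := tail n m.
apply: le_trans (_ : (b (n + m)%N + a) ^+ 2 <= _); last first.
  rewrite ler_pXn2r ?nnegrE ?addr_ge0 ?b0 // ?(ltW e0) //.
  rewrite addrC lerD2l; apply: le_trans (ltW hm).
  by rewrite /b exprD !mulrA.
apply: le_trans (minkowski2_seq (b0 _) a0 (hb _) (h _ us)).
apply: ler_sum => k _; rewrite ler_pXn2r ?nnegrE ?wnorm_ge0 ?addr_ge0 ?wnorm_ge0 //.
apply: le_trans (wnormD _ _ _); rewrite le_eqVlt; apply/orP; left; apply/eqP.
by congr (wnorm _ k); apply/funext => i; rewrite /= addrA subrK.
Qed.

End WeightedL2.

(** * The operator [tau - A]: a priori bound, dense range, surjectivity *)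

Section TauSub.
Variables (R : realType) (H : completeNormedModType R[i]) (rho : R).
Hypothesis rho0 : 0 < rho.
Variable ip : H -> H -> R[i].
Hypothesis ipP : is_inner_product ip.
Variable A : H -> H.
Hypotheses (Alin : linear A) (Acont : continuous A).
Variable M : R.
Hypotheses (M0 : 0 <= M) (resA : forall z : R[i], circle rho z -> exists B : H -> H,
  [/\ forall x, B (z *: x - A x) = x, forall x, z *: B x - A (B x) = x
    & forall x, hnorm (B x) <= M * hnorm x]).

(** Averages of powers over the sample points of the circle; the range of [e] keeps a nonzero
    frequency from aliasing to 0. *)
Lemma sum_circle_exprz n (z : R[i]) (e : int) : n.-primitive_root z ->
  - n%:Z < e < n%:Z ->
  \sum_(j < n) (rho%:C * z ^ (- j%:Z)) ^ e = if e == 0 then n%:R else 0.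
Proof.
move=> zn en; have z0 : z != 0 by rewrite -normr_gt0 (norm_prim_root zn).
(* Natural exponents with [b - a = e], so that the negative power of [z] becomes a quotient of two
   characters. *)
pose a := if e < 0 then absz e else 0%N; pose b := if e < 0 then 0%N else absz e.
have an : (a < n)%N by rewrite /a; case: ifP; move: en; clear; lia.
have bn : (b < n)%N by rewrite /b; case: ifP; move: en; clear; lia.
have abE : - e = a%:Z - b%:Z by rewrite /a /b; case: ifP; clear; lia.
transitivity ((rho%:C) ^ e * \sum_(j < n) (z ^+ a / z ^+ b) ^+ j).
  rewrite mulr_sumr; apply: eq_bigr => j _; rewrite expfzMl; congr (_ * _).
  rewrite exprz_exp !exprnP invr_expz -expfzDr // -abE exprz_exp.
  by rewrite !mulNr mulrC.
rewrite (sum_prim_root_expr (Ordinal an) (Ordinal bn) zn) -val_eqE /=.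
have -> : (a == b) = (e == 0) by move: abE; clear; lia.
by case: eqP => [->|_]; rewrite ?expr0z ?mul1r ?mulr0.
Qed.

Lemma A0 : A 0 = 0.
Proof.
have := Alin 1 0 0; rewrite !scale1r addr0 => /eqP.
by rewrite -subr_eq0 opprD addrA subrr sub0r oppr_eq0 => /eqP.
Qed.

Lemma AZ a x : A (a *: x) = a *: A x.
Proof. by have := Alin a x 0; rewrite A0 !addr0. Qed.

Lemma AD x y : A (x + y) = A x + A y.
Proof. by have := Alin 1 x y; rewrite !scale1r. Qed.

Lemma AB x y : A (x - y) = A x - A y.
Proof. by rewrite AD -scaleN1r AZ scaleN1r. Qed.

Lemma A_sum (I : finType) (x : I -> H) : A (\sum_i x i) = \sum_i A (x i).
Proof. by elim/big_rec2: _ => [|i y1 y2 _ <-]; [exact: A0 | exact: AD]. Qed.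

Lemma circle_prim_root n (z : R[i]) j : n.-primitive_root z ->
  circle rho (rho%:C * z ^ (- j%:Z)).
Proof.
move=> zn; rewrite /circle /= normrM -invr_expz normfV normrX (norm_prim_root zn).
by rewrite expr1n invr1 mulr1 ger0_norm // ler0c ltW.
Qed.

(** By periodicity the transform of [rho y_(k+1) - A y_k] at frequency [j] is [z_j - A] applied to
    that of [y], with [z_j = rho z^(-j)] on the circle. The resolvent bound at each frequency,
    between two uses of Parseval, gives the estimate. *)
Lemma periodic_bound n (y : nat -> H) : (0 < n)%N -> y n = y 0%N ->
  \sum_(k < n) hnorm (y k) ^+ 2 <=
  M ^+ 2 * \sum_(k < n) hnorm (rho%:C *: y k.+1 - A (y k)) ^+ 2.
Proof.
move=> n_gt0 yper.
have [z zn] : exists z : R[i], n.-primitive_root z.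
  by apply: prim_root_exists; rewrite pnatr_eq0 -lt0n.
have z0 : z != 0 by rewrite -normr_gt0 (norm_prim_root zn).
rewrite -(ler_pM2l (_ : 0 < n%:R)) ?ltr0n // mulrCA -(parseval ipP _ zn).
rewrite -(parseval ipP (fun k => rho%:C *: y k.+1 - A (y k)) zn) mulr_sumr.
apply: ler_sum => j _; rewrite -exprMn.
rewrite ler_pXn2r ?nnegrE ?hnorm_ge0 ?mulr_ge0 ?hnorm_ge0 //.
have [B [Bl _ Ble]] := resA (circle_prim_root j zn).
rewrite -[X in hnorm X]Bl; apply: le_trans (Ble _) _.
rewrite le_eqVlt; apply/orP; left; apply/eqP; congr (_ * hnorm _).
pose f k := z ^+ (j * k) *: y k.
have shift : \sum_(k < n) f k.+1 = \sum_(k < n) f k.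
  have : \sum_(k < n) f k.+1 + f 0%N = \sum_(k < n) f k + f n.
    transitivity (\sum_(k < n.+1) f k); last by rewrite big_ord_recr.
    by rewrite big_ord_recl addrC.
  have -> : f n = f 0%N.
    by rewrite /f yper mulnC exprM (prim_expr_order zn) expr1n muln0.
  by move/addIr.
rewrite A_sum -{1}shift scaler_sumr -sumrB; apply: eq_bigr => k _.
rewrite AZ scalerBr /f !scalerA; congr (_ *: _ - _).
rewrite mulnS exprD -invr_expz -exprnP -mulrA mulKf ?expf_neq0 //.
exact: mulrC.
Qed.

(** Changing [y] at the single index [n] closes it up to a periodic sequence, at the price of one
    defect term. *)
Lemma defect_bound n (y : nat -> H) d : (0 < n)%N -> 0 <= d ->
  \sum_(k < n) hnorm (rho%:C *: y k.+1 - A (y k)) ^+ 2 <= d ^+ 2 ->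
  \sum_(k < n) hnorm (y k) ^+ 2 <= (M * (d + rho * hnorm (y 0%N - y n))) ^+ 2.
Proof.
move=> n0 d0 hd; pose y' k := y k + (if k == n then y 0%N - y n else 0).
have y'E (k : 'I_n) : y' k = y k by rewrite /y' (ltn_eqF (ltn_ord k)) addr0.
have per : y' n = y' 0%N.
  by rewrite /y' eqxx (ltn_eqF n0) addr0 addrC subrK.
have := periodic_bound n0 per.
under eq_bigr do rewrite y'E.
move/le_trans; apply; rewrite exprMn ler_wpM2l ?sqr_ge0 //.
(* Only the defect at [n - 1] involves the entry at [n]. *)
pose b (k : 'I_n) := if k.+1 == n then rho * hnorm (y 0%N - y n) else 0.
have b0 : 0 <= rho * hnorm (y 0%N - y n) by rewrite mulr_ge0 ?hnorm_ge0 // ltW.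
have hb : \sum_(k < n) b k ^+ 2 <= (rho * hnorm (y 0%N - y n)) ^+ 2.
  case: n n0 @y' y'E @b b0 {hd per} => // n _ y' y'E b b0.
  rewrite (bigD1 ord_max) //= /b eqxx big1 ?addr0 // => k.
  by rewrite -val_eqE /= eqSS => /negbTE ->; rewrite expr0n.
apply: le_trans (minkowski2_seq d0 b0 hd hb); apply: ler_sum => k _.
rewrite ler_pXn2r ?nnegrE ?addr_ge0 ?hnorm_ge0 //; last first.
  by rewrite /b; case: ifP.
rewrite y'E /y' /b; case: ifP => _; last by rewrite !addr0.
rewrite scalerDr -addrA [_ *: (y 0%N - y n) - _]addrC addrA.
by apply: le_trans (ler_hnormD _ _) _; rewrite hnormZr // ltW.
Qed.

Definition tau_sub (u : int -> H) : int -> H := fun k => u (k + 1) - A (u k).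

Lemma tau_subB u v : tau_sub (u - v) = tau_sub u - tau_sub v.
Proof.
apply/funext => k; rewrite /tau_sub /=.
rewrite -[(u - v) (k + 1)]/(u (k + 1) - v (k + 1)) -[(u - v) k]/(u k - v k) AB.
by rewrite -[RHS]/(u (k + 1) - A (u k) - (v (k + 1) - A (v k))) !opprD !opprK addrACA.
Qed.

Lemma tau_subD u v : tau_sub (u + v) = tau_sub u + tau_sub v.
Proof.
apply/funext => k; rewrite /tau_sub /=.
rewrite -[(u + v) (k + 1)]/(u (k + 1) + v (k + 1)) -[(u + v) k]/(u k + v k) AD.
by rewrite -[RHS]/(u (k + 1) - A (u k) + (v (k + 1) - A (v k))) opprD addrACA.
Qed.

(** Square summability of [u] provides windows whose end terms are arbitrarily small, so the cost of
    closing them up vanishes and [M * d] remains. *)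
Lemma tau_sub_bound u c d : l2le rho u c -> l2le rho (tau_sub u) d -> l2le rho u (M * d).
Proof.
move=> hu [d0 hd]; split=> [|s us]; first exact: mulr_ge0.
apply: ler_sqr_addgt0; first exact: mulr_ge0.
move=> e e0.
have Mp : 0 < M + 1 by rewrite ltr_wpDl.
(* Chosen so that [(M + 1) * rho * (e1 + e1) = e]; [M + 1] replaces [M], which may be 0. *)
pose e1 := e / (M + 1) / rho / 2.
have e10 : 0 < e1 by rewrite !divr_gt0.
(* Starting the search for end points beyond [m] makes the window contain [s]. *)
have [m m0 sm] : exists2 m, (0 < m)%N & forall k, k \in s -> (absz k < m)%N.
  by exists (\max_(k <- s) absz k).+1 => // k ks; rewrite ltnS leq_bigmax_seq.
have [n1 h1] : exists n, wnorm rho u (- (m + n)%N%:Z) <= e1.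
  by apply: (l2le_wnorm_small rho0 hu _ e10) => i j; clear; lia.
have [n2 h2] : exists n, wnorm rho u ((m + n)%N%:Z) <= e1.
  by apply: (l2le_wnorm_small rho0 hu _ e10) => i j; clear; lia.
have [a aE] : exists a, a = - (m + n1)%N%:Z by eexists.
have [n nE] : exists n, n = (m + n1 + (m + n2))%N by eexists.
have n0 : (0 < n)%N by rewrite nE -addnA addn_gt0 m0.
have endE : a + n%:Z = (m + n2)%N%:Z by move: aE nE; clear; lia.
(* This scaling absorbs the weight: [y k] has the norm of the weighted term of [u], and the periodic
   defect that of [tau_sub u]. *)
pose y (k : nat) := (rho ^ (- (a + k%:Z)))%:C *: u (a + k%:Z).
have yn k : hnorm (y k) = wnorm rho u (a + k%:Z).
  by rewrite hnormZr ?(ltW (exprz_gt0 _ rho0)) // mulrC.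
have gn k : hnorm (rho%:C *: y k.+1 - A (y k)) = wnorm rho (tau_sub u) (a + k%:Z).
  rewrite /wnorm mulrC -hnormZr ?(ltW (exprz_gt0 _ rho0)) //; congr hnorm.
  rewrite /y; have -> : a + k.+1%:Z = a + k%:Z + 1 by clear; lia.
  rewrite AZ /tau_sub scalerBr scalerA -rmorphM /= opprD expfzDr ?gt_eqF //.
  by rewrite exprN1 mulrCA mulfV ?mulr1 ?gt_eqF.
have win (f : int -> R) : \sum_(k < n) f (a + k%:Z) =
    \sum_(k <- [seq a + k%:Z | k <- iota 0 n]) f k.
  by rewrite big_map -(big_mkord xpredT (fun k : nat => f (a + k%:Z))) /index_iota subn0.
have wu : uniq [seq a + k%:Z | k <- iota 0 n].
  by rewrite map_inj_uniq ?iota_uniq // => i j; clear; lia.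
have hg : \sum_(k < n) hnorm (rho%:C *: y k.+1 - A (y k)) ^+ 2 <= d ^+ 2.
  by under eq_bigr do rewrite gn;
    rewrite (win (fun k => wnorm rho (tau_sub u) k ^+ 2)); apply: hd.
have := defect_bound n0 d0 hg.
under eq_bigr do rewrite yn.
rewrite (win (fun k => wnorm rho u k ^+ 2)) => le.
apply: le_trans (_ : \sum_(k <- [seq a + k%:Z | k <- iota 0 n]) wnorm rho u k ^+ 2 <= _).
  apply: ler_sum_seq_sub => // [k|k /sm ks]; first exact: sqr_ge0.
  case/negP; apply/mapP; exists (absz (k - a)).
    by rewrite mem_iota; move: ks aE nE; clear; lia.
  by move: ks aE; clear; lia.
apply: le_trans le _; rewrite ler_pXn2r ?nnegrE ?addr_ge0 ?mulr_ge0 ?addr_ge0 ?mulr_ge0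
  ?hnorm_ge0 ?(ltW e0) ?(ltW rho0) //.
rewrite mulrDr lerD2l.
have yy : hnorm (y 0%N - y n) <= e1 + e1.
  apply: le_trans (ler_hnormD _ _) _; rewrite hnormN !yn addr0.
  apply: lerD; first by rewrite aE.
  by rewrite endE.
apply: le_trans (_ : (M + 1) * (rho * (e1 + e1)) <= _); last first.
  by rewrite /e1 le_eqVlt; apply/orP; left; apply/eqP; field; rewrite !gt_eqF.
apply: ler_pM => //; rewrite ?mulr_ge0 ?hnorm_ge0 ?(ltW rho0) //.
  by rewrite lerDl.
by rewrite ler_wpM2l // ltW.
Qed.

(* The solution of the [n]-periodic problem with data [x] at index [m] is cut
   at an index [m - i] at which, by Parseval and pigeonhole, it is small. *)
Lemma dirac_approx m x e : 0 < e -> exists v c,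
  l2le rho v c /\ l2le rho (tau_sub v - dirac_seq m x) e.
Proof.
move=> e0.
(* With this threshold each of the two residues left by the cut has weighted norm at most [e / 2];
   [n] is taken large enough for the pigeonhole below. *)
have t0 : 0 < e / 2 / rho / rho ^ (- m) by rewrite !divr_gt0 ?exprz_rho_gt0.
have [n n0 hn] : exists2 n, (0 < n)%N &
    (M * hnorm x) ^+ 2 <= n%:R * (e / 2 / rho / rho ^ (- m)) ^+ 2.
  exists (Num.bound ((M * hnorm x) ^+ 2 / (e / 2 / rho / rho ^ (- m)) ^+ 2)).+1 => //.
  rewrite -ler_pdivrMr ?exprn_gt0 //; apply/ltW/(lt_le_trans (archi_boundP _)).
    by rewrite divr_ge0 ?sqr_ge0.
  by rewrite ler_nat.
have [z zn] : exists z : R[i], n.-primitive_root z.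
  by apply: prim_root_exists; rewrite pnatr_eq0 -lt0n.
have z0 : z != 0 by rewrite -normr_gt0 (norm_prim_root zn).
have rhoC0 : rho%:C != 0 by rewrite gt_eqF // ltcR.
pose w j := rho%:C * z ^ (- j%:Z).
have w0 j : w j != 0 by rewrite mulf_neq0 // expfz_neq0.
have [B hB] : exists B : nat -> H, forall j,
    w j *: B j - A (B j) = x /\ hnorm (B j) <= M * hnorm x.
  suff h j : exists b, w j *: b - A b = x /\ hnorm b <= M * hnorm x.
    by exists (fun j => sval (cid (h j))) => j; apply: svalP (cid (h j)).
  by have [B [_ Br Ble]] := resA (circle_prim_root j zn); exists (B x).
(* The mean over the sample points of [z^(k - m) (z - A)^(-1) x], a discretised contour integral. *)
pose y k := (n%:R)^-1 *: \sum_(j < n) w j ^ (k - m) *: B j.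
(* The restriction on [k] matters: the source recurs, scaled, at distance [n] from [m]. *)
have yE k : m - n%:Z < k < m + n%:Z -> A (y k) = y (k + 1) - dirac_seq m x k.
  move=> kmn; suff <- : y (k + 1) - A (y k) = dirac_seq m x k.
    by rewrite opprB addrC subrK.
  rewrite /y AZ A_sum -scalerBr -sumrB.
  transitivity (n%:R^-1 *: ((\sum_(j < n) w j ^ (k - m)) *: x)).
    congr (_ *: _); rewrite scaler_suml; apply: eq_bigr => j _.
    rewrite AZ addrAC expfzDr // expr1z -scalerA -scalerBr.
    by have [-> _] := hB j.
  rewrite (sum_circle_exprz zn); last by move: kmn; clear; lia.
  rewrite subr_eq0 /dirac_seq; case: eqP => _; last by rewrite scale0r scaler0.
  by rewrite scalerA mulVf ?scale1r // pnatr_eq0 -lt0n.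
have per k : y (k + n%:Z) = (rho ^ n%:Z)%:C *: y k.
  rewrite /y [RHS]scalerA [X in _ = X *: _]mulrC -scalerA.
  congr (_ *: _); rewrite scaler_sumr.
  apply: eq_bigr => j _; rewrite addrAC expfzDr // mulrC scalerA; congr (_ * _ *: _).
  rewrite expfzMl exprz_exp [- j%:Z * n%:Z]mulrC -exprz_exp -!exprnP.
  by rewrite (prim_expr_order zn) exp1rz mulr1 rmorphXn.
have [i [hi small]] : exists i, (i < n)%N /\
    rho ^ i%:Z * hnorm (y (m - i%:Z)) <= e / 2 / rho / rho ^ (- m).
  move: (e / 2 / rho / rho ^ (- m)) t0 hn => t t0 hn.
  pose S (i : nat) := \sum_(j < n) z ^+ (i * j) *: B j.
  have nR : 0 < n%:R :> R by rewrite ltr0n.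
  have yS i : rho ^ i%:Z * hnorm (y (m - i%:Z)) = n%:R^-1 * hnorm (S i).
    have -> : y (m - i%:Z) = (n%:R^-1 * rho ^ (- i%:Z))%:C *: S i.
      rewrite /y rmorphM fmorphV rmorph_nat -scalerA; congr (_ *: _).
      rewrite scaler_sumr; apply: eq_bigr => j _; rewrite scalerA; congr (_ *: _).
      rewrite addrAC subrr add0r expfzMl exprz_exp mulrNN -exprnP; congr (_ * _).
        by rewrite -invr_expz -invr_expz fmorphV -!exprnP rmorphXn.
      by rewrite mulnC.
    rewrite hnormZr; last by rewrite mulr_ge0 ?invr_ge0 ?ler0n // ltW ?exprz_rho_gt0.
    by rewrite mulrCA !mulrA -invr_expz mulfVK // gt_eqF ?exprz_rho_gt0.
  (* If every index failed, the squares of the [S i] would sum to more than [n (n t)^2], while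
     Parseval bounds the sum by [n^2 (M |x|)^2]; the choice of [n] excludes this. *)
  apply: contrapT => /forallNP big.
  have : \sum_(i < n) (n%:R * t) ^+ 2 < \sum_(i < n) hnorm (S i) ^+ 2.
    apply: ltr_sum => [|i _].
      by apply/hasP; exists (Ordinal n0); rewrite ?mem_index_enum.
    rewrite ltr_pXn2r ?nnegrE ?hnorm_ge0 // ?mulr_ge0 ?(ltW t0) ?(ltW nR) //.
    rewrite -ltr_pdivlMl // -yS ltNge; apply/negP => le; apply: (big i).
    by split.
  rewrite (parseval ipP B zn) sumr_const card_ord -[X in X < _]mulr_natl ltr_pM2l //.
  apply/negP; rewrite -leNgt exprMn [n%:R ^+ 2]expr2 -mulrA.
  apply: (@le_trans _ _ (\sum_(j < n) (M * hnorm x) ^+ 2)).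
    apply: ler_sum => j _; rewrite ler_pXn2r ?nnegrE ?hnorm_ge0 ?mulr_ge0 ?hnorm_ge0 //.
    by have [] := hB j.
  by rewrite sumr_const card_ord -[leLHS]mulr_natl ler_wpM2l // ltW.
have [k0 k0E] : exists k0, k0 = m - i%:Z by eexists.
(* One period of [y], containing [m] because [i < n]. Cutting creates residues only at [k0 - 1] and
   [k0 + n - 1]. *)
pose v k := if k0 <= k < k0 + n%:Z then y k else 0.
have Tv : tau_sub v - dirac_seq m x =
    dirac_seq (k0 - 1) (y k0) - dirac_seq (k0 + n%:Z - 1) (y (k0 + n%:Z)).
  apply/funext => k.
  rewrite -[LHS]/(v (k + 1) - A (v k) - dirac_seq m x k).
  rewrite -[RHS]/(dirac_seq _ _ k - dirac_seq _ _ k) /v.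
  have [kw|kw] := boolP (k0 <= k < k0 + n%:Z).
    rewrite yE; last by move: kw hi k0E; clear; lia.
    rewrite opprB addrA addrAC addrK /dirac_seq.
    have -> : (k == k0 - 1) = false by move: kw; clear; lia.
    rewrite sub0r; case: (eqVneq k) => [->|kn].
      have -> : (k0 <= k0 + n%:Z - 1 + 1 < k0 + n%:Z) = false by clear; lia.
      by rewrite subrK sub0r.
    have -> : (k0 <= k + 1 < k0 + n%:Z) = true by move: kw kn; clear; lia.
    by rewrite subrr oppr0.
  rewrite A0 subr0 /dirac_seq.
  have -> : (k == m) = false by move: kw hi k0E; clear; lia.
  have -> : (k == k0 + n%:Z - 1) = false by move: kw n0; clear; lia.
  rewrite !subr0; case: (eqVneq k) => [->|kn].
    by rewrite subrK (_ : _ <= _ < _ = true) //; move: n0; clear; lia.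
  by rewrite (_ : _ <= _ < _ = false) //; move: kw kn; clear; lia.
exists v; eexists; split.
  apply: (l2le_finsupp rho (w := [seq k0 + k%:Z | k <- iota 0 n])).
    by rewrite map_inj_uniq ?iota_uniq // => a b; clear; lia.
  move=> k; rewrite /v; case: ifP => // kw; case/negP; apply/mapP.
  by exists (absz (k - k0)); rewrite ?mem_iota; move: kw; clear; lia.
rewrite Tv; apply: l2le_le (l2leB rho0 (l2le_dirac rho0 _ _) (l2le_dirac rho0 _ _)).
rewrite per hnormZr ?(ltW (exprz_rho_gt0 rho0 _)) // k0E.
have rhoN : rho != 0 by rewrite gt_eqF.
have ep k : rho ^ k != 0 by rewrite gt_eqF ?exprz_rho_gt0.
have -> : - (m - i%:Z - 1) = i%:Z + 1 + - m by clear; lia.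
have -> : - (m - i%:Z + n%:Z - 1) = i%:Z + 1 + - m - n%:Z by clear; lia.
rewrite [rho ^ (_ - n%:Z)]expfzDr // -[rho ^ (- n%:Z)]invr_expz.
(* Both residues have the same weighted norm: the factor [rho ^ n] from [per] cancels the weight
   between the two ends. *)
have half : hnorm (y (m - i%:Z)) * rho ^ (i%:Z + 1 - m) <= e / 2.
  rewrite !expfzDr // expr1z; move: small (ep (- m)) (exprz_rho_gt0 rho0 (- m)).
  move: (rho ^ i%:Z) (rho ^ (- m)) (hnorm _) => a b h small b0 bp.
  rewrite -(ler_pM2r (_ : 0 < rho * b)) ?mulr_gt0 // in small.
  rewrite [leRHS](_ : _ = e / 2) in small; last by field; rewrite ?rhoN ?b0.
  by apply: le_trans small; rewrite le_eqVlt; apply/orP; left; apply/eqP; ring.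
rewrite [leRHS]splitr; apply: lerD => //; apply: le_trans half.
move: (rho ^ n%:Z) (ep n%:Z) (rho ^ (i%:Z + 1 - m)) (hnorm _) => P Pn a h.
by rewrite le_eqVlt; apply/orP; left; apply/eqP; field; exact: Pn.
Qed.

(** Truncate [f] to finitely many entries at cost [e / 2], then superpose approximate solutions for
    the single entries, splitting the remaining error in halves. *)
Lemma tau_sub_dense f d e : l2le rho f d -> 0 < e -> exists v c,
  l2le rho v c /\ l2le rho (tau_sub v - f) e.
Proof.
move=> hf e0; have e20 : 0 < e / 2 by rewrite divr_gt0.
have [s us hs] := l2le_tail hf e20.
have : forall e', 0 < e' -> exists v c, l2le rho v c /\
    l2le rho (tau_sub v - (fun k => if k \in s then f k else 0)) e'.
  elim: s us {hs} => [_|m s IH /andP[ms us]] e' e'0.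
    exists 0, 0; split; first exact: l2le0.
    apply: l2le_le (ltW e'0) _; rewrite (_ : _ - _ = 0); first exact: l2le0.
    apply/funext => k; rewrite -[LHS]/(0 - A 0 - 0); by rewrite A0 !subr0.
  have e'20 : 0 < e' / 2 by rewrite divr_gt0.
  have [v1 [c1 [hv1 h1]]] := IH us _ e'20.
  have [v2 [c2 [hv2 h2]]] := dirac_approx m (f m) e'20.
  exists (v1 + v2), (c1 + c2); split; first exact: l2leD.
  have := l2leD rho0 h1 h2; rewrite -splitr; congr l2le.
  rewrite tau_subD addrACA -opprD; congr (_ - _); apply/funext => k.
  rewrite -[LHS]/((if k \in s then f k else 0) + dirac_seq m (f m) k) /dirac_seq inE.
  by case: eqVneq => [->|_] /=; rewrite ?(negbTE ms) ?add0r ?addr0.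
move=> /(_ _ e20) [v [c [hv h]]]; exists v, c; split=> //.
have := l2leB rho0 h hs; rewrite -splitr; congr l2le.
rewrite -addrA -opprD; congr (_ - _); apply/funext => k.
rewrite -[LHS]/((if k \in s then f k else 0) + (if k \in s then 0 else f k)).
by case: ifP; rewrite ?add0r ?addr0.
Qed.

(** Dense range becomes surjectivity: by the a priori bound, approximate solutions with residual
    [2^-n] converge geometrically, and continuity of [A] carries the equation to the limit entry by
    entry. *)
Lemma tau_sub_solve f d : l2le rho f d -> exists u c, l2le rho u c /\ tau_sub u = f.
Proof.
move=> hf; have d0 : 0 <= d by case: hf.
have [V hV] : exists V : nat -> int -> H, forall n, exists c, l2le rho (V n) c /\
    l2le rho (tau_sub (V n) - f) (2^-1 ^+ n).
  suff h n : exists v, exists c, l2le rho v c /\ l2le rho (tau_sub v - f) (2^-1 ^+ n).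
    by exists (fun n => sval (cid (h n))) => n; apply: svalP (cid (h n)).
  by apply: (tau_sub_dense hf); rewrite exprn_gt0 // invr_gt0.
have [l hl] : exists l, forall n, l2le rho (l - V n) (M * 2 * 2^-1 ^+ n / (1 - 2^-1)).
  apply: l2le_complete => //; first by lra.
    by rewrite mulr_ge0.
  move=> n; have [c1 [h1 k1]] := hV n.+1; have [c2 [h2 k2]] := hV n.
  have : l2le rho (tau_sub (V n.+1 - V n)) (2^-1 ^+ n.+1 + 2^-1 ^+ n).
    have := l2leB rho0 k1 k2; congr l2le; rewrite tau_subB.
    by rewrite opprB addrA subrK.
  move/(tau_sub_bound (l2leB rho0 h1 h2)); apply: l2le_le.
  rewrite -mulrA ler_wpM2l // exprS.
  have : 0 <= 2^-1 ^+ n :> R by rewrite exprn_ge0.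
  by move: (2^-1 ^+ n) => a; lra.
have [c0 [h0 _]] := hV 0%N.
exists l; eexists; split.
  by have := l2leD rho0 (hl 0%N) h0; rewrite subrK; apply.
apply/funext => k.
have ptw (W : nat -> int -> H) (l' : int -> H) c i :
    (forall n, l2le rho (l' - W n) (c * 2^-1 ^+ n)) -> (fun n => W n i) @ \oo --> l' i.
  move=> hW; apply: (@geometric_hnorm_cvg _ _ _ _ (c * rho ^ i) 2^-1); first lra.
  move=> n; have := l2le_wnorm rho0 i (hW n).
  by rewrite /wnorm -invr_expz ler_pdivrMr ?exprz_rho_gt0 // mulrAC.
have Vl i : (fun n => V n i) @ \oo --> l i.
  apply: (@ptw _ _ (M * 2 / (1 - 2^-1))) => n.
  by have := hl n; rewrite mulrAC.
have Vf : (fun n => tau_sub (V n) k) @ \oo --> f k.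
  apply: (@ptw (fun n => tau_sub (V n)) _ 1) => n; rewrite mul1r.
  by have [c [_ /l2leN]] := hV n; rewrite opprB.
apply: (@cvg_unique _ (@norm_hausdorff _ H) _ _ _ _ _ Vf).
apply: cvgB; first exact: Vl.
by apply: continuous_cvg; [exact: Acont | exact: Vl].
Qed.

End TauSub.

(** * Operator norms and the uniform resolvent bound *)

Section Resolvent.
Variables (R : realType) (H : completeNormedModType R[i]).
Implicit Types (A B : H -> H) (x : H).

Lemma bounded_op_bound B : bounded_op B ->
  exists2 K : R, 0 <= K & forall x, hnorm (B x) <= K * hnorm x.
Proof.
move=> [Blin Bcont].
pose BL : {linear H -> H} := HB.pack B (GRing.isLinear.Build _ _ _ _ B Blin).
have /linear_boundedP := @continuous_linear_bounded _ _ _ 0 BL (Bcont 0).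
move=> /pinfty_ex_gt0[K K0 BK].
have Kr : K = (complex.Re K)%:C by rewrite RRe_real // gtr0_real.
exists (complex.Re K); first by rewrite -ler0c -Kr ltW.
by move=> x; have := BK x; rewrite !normE Kr -rmorphM lecR.
Qed.

Lemma opnorm_ge0 B : bounded_op B -> 0 <= opnorm B.
Proof.
by move=> /bounded_op_bound[K K0 BK]; apply: lb_le_inf => [|N []]; first by exists K.
Qed.

(** For [x] of positive norm, the quotient of the two norms is a lower bound of all admissible
    constants, hence at most their infimum. *)
Lemma ler_opnorm B x : bounded_op B -> hnorm (B x) <= opnorm B * hnorm x.
Proof.
move=> Bb; have [K K0 BK] := bounded_op_bound Bb.
have := hnorm_ge0 x; rewrite le_eqVlt => /predU1P[x0|x0].
  by apply: le_trans (BK x) _; rewrite -x0 !mulr0.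
rewrite -ler_pdivrMr //; apply: lb_le_inf => [|N [_ BN]]; first by exists K.
by rewrite ler_pdivrMr.
Qed.

Lemma resolvent_M_rho A (rho : R) : 0 < rho ->
  (forall z, circle rho z -> ~ spectrum A z) -> has_ubound (resolvent_norms A rho) ->
  0 <= M_rho A rho /\
  forall z, circle rho z -> exists B : H -> H,
    [/\ forall x, B (z *: x - A x) = x, forall x, z *: B x - A (B x) = x
      & forall x, hnorm (B x) <= M_rho A rho * hnorm x].
Proof.
move=> rho0 spec ub.
have res z : circle rho z -> exists2 B, is_resolvent A z B & opnorm B <= M_rho A rho.
  move=> zr; have /contrapT [B hB] := spec z zr; exists B => //.
  by apply: ub_le_sup => //; exists z, B.
split=> [|z /res [B [Bb [Bl Br]] le]].
  (* The point [rho] of the circle furnishes a resolvent, whose nonnegative norm lies below the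
     supremum. *)
  have [|B [Bb _]] := res rho%:C; first by rewrite /circle /= ger0_norm // ler0c ltW.
  by apply: le_trans; apply: opnorm_ge0.
exists B; split=> // x; apply: le_trans (ler_opnorm x Bb) _.
by rewrite ler_wpM2r ?hnorm_ge0.
Qed.

End Resolvent.

(** * The contraction argument *)

Theorem theorem4p1 (R : realType) (H : completeNormedModType R[i])
  (A : H -> H) (rho : R) (F : (int -> H) -> (int -> H)) :
  separable_hilbert H ->
  bounded_op A ->
  0 < rho ->
  (forall z, circle rho z -> ~ spectrum A z) ->
  has_ubound (resolvent_norms A rho) ->
  l2rho_selfmap rho F ->
  (exists L, l2rho_lipschitz rho F L) ->
  lipconst rho F * M_rho A rho < 1 ->
  forall x : H, exists! u : int -> H,
    in_l2rho rho u /\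
    forall n : int, tau_shift u n = A (u n) + F u n + delta_m1 x n.
Proof.
move=> [[ip ipP] _] [Alin Acont] rho0 spec ub Fself [L0 FL0] small x.
have [M0 res] := resolvent_M_rho rho0 spec ub.
move: (M_rho A rho) M0 res small => M M0 res small.
(* [lipconst] is an infimum; an actual Lipschitz constant with [L * M < 1] is extracted. If [M = 0],
   any one will do. *)
have [L FL LM] : exists2 L, l2rho_lipschitz rho F L & L * M < 1.
  move: M0; rewrite le_eqVlt => /predU1P[<-|M0]; first by exists L0; rewrite ?mulr0.
  have [||L FL LM] := @inf_lt _ [set L | l2rho_lipschitz rho F L] M^-1.
  - by exists L0.
  - by rewrite -div1r ltr_pdivlMr.
  by exists L => //; rewrite -ltr_pdivlMr // div1r.
have [Lpos Lip] := FL.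
have q01 : 0 <= M * L < 1 by rewrite mulr_ge0 //= mulrC.
have FLip u v a b c : l2le rho u a -> l2le rho v b -> l2le rho (u - v) c ->
    l2le rho (F u - F v) (L * c).
  move=> hu hv huv.
  have iu := l2le_in_l2rho hu; have iv := l2le_in_l2rho hv.
  have hF := l2leB rho0 (in_l2rho_l2le rho0 (Fself _ iu))
    (in_l2rho_l2le rho0 (Fself _ iv)).
  apply: l2le_le (in_l2rho_l2le rho0 (l2le_in_l2rho hF)).
  apply: le_trans (Lip _ _ iu iv) _.
  by rewrite ler_wpM2l // l2le_norm_le.
(* Stated for any [u'], [v'] with the right difference of images, so that it serves the iteration,
   the fixed point and uniqueness alike. *)
have contract u v u' v' a b a' b' c : l2le rho u a -> l2le rho v b ->
    l2le rho u' a' -> l2le rho v' b' ->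
    tau_sub A u' - tau_sub A v' = F u - F v ->
    l2le rho (u - v) c -> l2le rho (u' - v') (M * L * c).
  move=> hu hv hu' hv' E huv; rewrite -mulrA.
  apply: (tau_sub_bound rho0 ipP Alin M0 res (l2leB rho0 hu' hv')).
  by rewrite tau_subB // E; apply: FLip hu hv huv.
pose G u := F u + dirac_seq (-1) x.
have GB u v : G u - G v = F u - F v by rewrite /G opprD addrACA subrr addr0.
have eqG u : (forall n, tau_shift u n = A (u n) + F u n + delta_m1 x n) <->
    tau_sub A u = G u.
  split=> [h|h n].
    apply/funext => n; rewrite /tau_sub -[u (n + 1)]/(tau_shift u n) h.
    by rewrite -[A _ + _ + _]addrA [A _ + _]addrC addrK.
  have := congr1 (fun f => f n) h; rewrite /tau_sub -[u (n + 1)]/(tau_shift u n).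
  move/eqP; rewrite subr_eq => /eqP ->.
  by rewrite -[G u n]/(F u n + delta_m1 x n) addrC addrA.
have solveG u a : l2le rho u a -> exists w c, l2le rho w c /\ tau_sub A w = G u.
  move=> hu; apply: (tau_sub_solve rho0 ipP Alin Acont M0 res).
  apply: l2leD => //; last exact: l2le_dirac.
  by apply: in_l2rho_l2le => //; apply: Fself; apply: l2le_in_l2rho hu.
(* [S] chooses a solution of [tau_sub A w = G u], with default value 0 outside the weighted space;
   its iterates from 0 are the Picard sequence. *)
have [S hS] : exists S : (int -> H) -> (int -> H), forall u, (exists a, l2le rho u a) ->
    (exists a, l2le rho (S u) a) /\ tau_sub A (S u) = G u.
  suff h u : exists w, (exists a, l2le rho u a) ->
      (exists a, l2le rho w a) /\ tau_sub A w = G u.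
    by exists (fun u => sval (cid (h u))) => u; apply: (svalP (cid (h u))).
  have [[a hu]|nu] := pselect (exists a, l2le rho u a); last by exists 0 => /nu.
  by have [w [c [hw E]]] := solveG u a hu; exists w => _; split=> //; exists c.
pose u_ n := iter n S 0.
have uin n : exists a, l2le rho (u_ n) a.
  by elim: n => [|n /hS[]] //; exists 0; apply: l2le0.
have [a1 h1] := uin 1%N.
have ustep n : l2le rho (u_ n.+1 - u_ n) (a1 * (M * L) ^+ n).
  elim: n => [|n IH]; first by rewrite subr0 expr0 mulr1.
  have [[b0 k0] [b1 k1] [b2 k2]] := And3 (uin n) (uin n.+1) (uin n.+2).
  rewrite exprS mulrCA; apply: (contract _ _ _ _ _ _ _ _ _ k1 k0 k2 k1 _ IH).
  by rewrite -GB (hS _ (uin n.+1)).2 (hS _ (uin n)).2.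
have [u hu] := l2le_complete rho0 q01 h1.1 ustep.
have uin' : exists a, l2le rho u a.
  by eexists; have := l2leD rho0 (hu 0%N) (l2le0 H rho); rewrite subrK; apply.
(* Both [u] and [S u] are within [e / 2] of the iterate [u_ n.+1], for suitable [n]. *)
have fix_u : u = S u.
  have [a ha] := uin'; have [[b hb] E] := hS _ uin'.
  apply: (l2le_small rho0) => e e0.
  have e20 : 0 < e / 2 by rewrite divr_gt0.
  have [n hn] := geometric_small a1 q01 e20.
  have [c hc] := uin n; have [d hd] := uin n.+1.
  have k1 : l2le rho (u - u_ n) (e / 2) by apply: l2le_le (ltW hn) (hu n).
  have k2 : l2le rho (S u - u_ n.+1) (M * L * (e / 2)).
    by apply: (contract _ _ _ _ _ _ _ _ _ ha hc hb hd _ k1);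
      rewrite -GB E (hS _ (uin n)).2.
  have k3 : l2le rho (u - u_ n.+1) (e / 2).
    apply: l2le_le (hu n.+1); apply: le_trans (ltW hn).
    have [/andP[q0 q1] [a10 _]] := (q01, h1).
    rewrite ler_wpM2r ?invr_ge0 ?subr_ge0 ?(ltW q1) // exprS ler_wpM2l //.
    by rewrite ler_piMl ?exprn_ge0 // ltW.
  have := l2leB rho0 k3 k2; rewrite opprB addrA subrK; apply: l2le_le.
  rewrite [leRHS]splitr lerD2l ler_piMl //; [exact: ltW | by case/andP: q01 => _ /ltW].
exists u; split.
  split; first by have [a /l2le_in_l2rho] := uin'.
  by apply/eqG; rewrite {1}fix_u; have [] := hS _ uin'.
move=> v [vin /eqG vG].
have uG : tau_sub A u = G u by rewrite {1}fix_u; have [] := hS _ uin'.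
have [a ha] := uin'; have hv := in_l2rho_l2le rho0 vin.
have huv := l2leB rho0 ha hv; have iuv := l2le_in_l2rho huv.
have hn := in_l2rho_l2le rho0 iuv.
(* Two solutions differ by a sequence whose norm is at most [M * L < 1] times itself, hence 0. *)
have hq : l2le rho (u - v) (M * L * l2rho_norm rho (u - v)).
  by apply: (contract _ _ _ _ _ _ _ _ _ ha hv ha hv _ hn); rewrite uG vG GB.
have n0 : l2rho_norm rho (u - v) = 0.
  apply/eqP; rewrite eq_le hn.1 andbT.
  have := l2le_norm_le rho0 hq; rewrite -subr_ge0 -{2}[l2rho_norm _ _]mul1r -mulrBl.
  by rewrite nmulr_rge0 // subr_lt0; case/andP: q01.
by apply: (l2le_small rho0) => e e0; apply: l2le_le hn; rewrite n0 ltW.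
Qed.
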